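(* Let $I\subset(0,\infty)$ be an interval, let $f:I\to\mathbb{R}$ be differentiable on $I^{\circ}$, and let $a,b\in I$ with $a<b$, where $f'$ exists at every point of $[a,b]$ (one-sided derivative at $a$ or $b$ if that point is an endpoint of $I$), and $f'\in L[a,b]$. Let $q>1$, $\frac1p+\frac1q=1$, and suppose $|f'|^q$ is harmonically convex on $[a,b]$. Then for every $\lambda\in[0,1]$ $$\left|(1-\lambda) f\left(\frac{2ab}{a+b}\right)+\lambda\,\frac{f(a)+f(b)}{2}-\frac{ab}{b-a}\int_a^b\frac{f(x)}{x^2}\,dx\right|$$ $$\le\frac{ab(b-a)}{4}\cdot\frac{C_4(\lambda,p)^{1/p}}{\left[(1-q)(1-2q)(b-a)^2\right]^{1/q}}\Big\{\big(C_5(q;a,b)|f'(a)|^q+C_6(q;a,b)|f'(b)|^q\big)^{\frac1q}$$ $$\qquad+\big(C_6(q;b,a)|f'(a)|^q+C_5(q;b,a)|f'(b)|^q\big)^{\frac1q}\Big\},$$ where $$C_4(\lambda,p)=\frac{\lambda^{p+1}+(1-\lambda)^{p+1}}{p+1},$$ and, for $u,\vartheta>0$, $$C_5(q;u,\vartheta)=\left(\frac{u+\vartheta}{2}\right)^{1-2q}\left[\frac{\vartheta-3u}{2}-q(\vartheta-u)\right]+u^{2-2q},$$ $$C_6(q;u,\vartheta)=\left(\frac{u+\vartheta}{2}\right)^{1-2q}\left[\frac{3\vartheta-u}{2}-q(\vartheta-u)\right]+u^{1-2q}\left[u-2\vartheta+2q(\vartheta-u)\right].$$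
   Context: A function $g:J\to\mathbb{R}$ on an interval $J\subset\mathbb{R}\setminus\{0\}$ is harmonically convex if $g\left(\frac{xy}{tx+(1-t)y}\right)\le t\,g(y)+(1-t)\,g(x)$ for all $x,y\in J$ and $t\in[0,1]$. $L[a,b]$ denotes the Lebesgue integrable functions on $[a,b]$. *)

(* Defs.v *)
From HB Require Import structures.
From mathcomp Require Import all_boot all_order all_algebra.
From mathcomp Require Import all_classical all_reals all_analysis.

Set Implicit Arguments.
Unset Strict Implicit.
Unset Printing Implicit Defensive.

Import Order.TTheory GRing.Theory Num.Theory.
Import numFieldNormedType.Exports.

Local Open Scope classical_set_scope.
Local Open Scope ring_scope.

(* A function f : J -> R is encoded by a total f : R -> R of which only the
   values on J are used. *)

(* Intended for an interval J that does not contain 0, so that the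
   denominator does not vanish. *)
Definition harmonically_convex (R : realType) (J : set R) (g : R -> R) : Prop :=
  forall x y t : R, J x -> J y -> 0 <= t <= 1 ->
    g (x * y / (t * x + (1 - t) * y)) <= t * g y + (1 - t) * g x.

(* The derivative of f relative to its domain J: the difference quotient is
   only taken at points y of J other than x.  It is the usual derivative at an
   interior point of J (derivable_withinE, derive_withinE below) and the
   one-sided one at an endpoint of J. *)
Definition diff_quotient (R : realType) (f : R -> R) (x y : R) : R :=
  (f y - f x) / (y - x).

Definition derivable_within (R : realType) (J : set R) (f : R -> R) (x : R)
    : Prop :=
  cvg (diff_quotient f x y @[y --> within J x^']).

Definition derive_within (R : realType) (J : set R) (f : R -> R) (x : R) : R :=
  lim (diff_quotient f x y @[y --> within J x^']).

Definition C4 (R : realType) (lambda p : R) : R :=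
  (lambda `^ (p + 1) + (1 - lambda) `^ (p + 1)) / (p + 1).

Definition C5 (R : realType) (q u v : R) : R :=
  ((u + v) / 2) `^ (1 - 2 * q) * ((v - 3 * u) / 2 - q * (v - u))
  + u `^ (2 - 2 * q).

Definition C6 (R : realType) (q u v : R) : R :=
  ((u + v) / 2) `^ (1 - 2 * q) * ((3 * v - u) / 2 - q * (v - u))
  + u `^ (1 - 2 * q) * (u - 2 * v + 2 * q * (v - u)).

Lemma within_interior_dnbhs (R : realType) (J : set R) (x : R) :
  J° x -> within J x^' = x^'.
Proof.
move=> Jx; have Jx' : x^' J by exact: nbhs_dnbhs Jx.
apply/seteqP; split => A; last exact: cvg_within.
by move=> JA; apply: filterS2 Jx' JA => z Jz; exact.
Qed.

Lemma diff_quotient_filterE (R : realType) (f : R -> R) (x : R) :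
  diff_quotient f x y @[y --> x^'] =
  (h^-1 *: (f (h *: 1 + x) - f x) @[h --> 0^']).
Proof.
apply/seteqP; split => A /= [e e0 H]; exists e => // y /= ye yx.
- have := H (y *: 1 + x).
  rewrite /diff_quotient /ball/= addrK /GRing.scale/= !mulr1 mulrC.
  apply; first by rewrite opprD addrCA subrr addr0 -sub0r.
  by rewrite -subr_eq0 addrK.
- have := H (y - x).
  rewrite /diff_quotient /ball/= /GRing.scale/= !mulr1 subrK mulrC.
  apply; first by rewrite sub0r opprB.
  by rewrite subr_eq0.
Qed.

Lemma derivable_withinE (R : realType) (J : set R) (f : R -> R) (x : R) :
  J° x -> derivable_within J f x <-> derivable f x 1.
Proof.
move=> Jx; rewrite /derivable_within within_interior_dnbhs//.
by rewrite diff_quotient_filterE.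
Qed.

Lemma derive_withinE (R : realType) (J : set R) (f : R -> R) (x : R) :
  J° x -> derive_within J f x = f^`()%classic x.
Proof.
move=> Jx; rewrite /derive_within within_interior_dnbhs//.
by rewrite diff_quotient_filterE derive1E.
Qed.

(* Main.v *)
(* Write (u, v) for (a, b) or (b, a), A = uv/x, t = (A - u)/(v - u),
   K = lambda - 2 t, m = 2ab/(a + b), and let G be a primitive of f(x)/x^2.
   The function psi = K f - 2uv/(v - u) G satisfies psi' = K f', and the left
   side of the theorem is half the norm of the sum of its increments between m
   and v for the two choices of (u, v).  By Young's inequality with a
   parameter d and harmonic convexity,
     |K f'| <= A^2 (d |K|^p / p
                    + d^(1-q) (t |f'(u)|^q + (1 - t) |f'(v)|^q) A^(-2q) / q),
   and the right side has an explicit primitive.  The mean value theorem then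
   bounds the increment of psi by that of this primitive, so that neither the
   integral of f' nor Hoelder's inequality for integrals is involved;
   minimising over d yields the product of powers of C4 and of
   C5 |f'(u)|^q + C6 |f'(v)|^q. *)
Require Import Defs.
From mathcomp Require Import all_boot all_order all_algebra.
From mathcomp Require Import all_classical all_reals all_analysis.
From mathcomp Require Import ring lra.

Import Order.TTheory GRing.Theory Num.Theory.
Import numFieldNormedType.Exports.

Local Open Scope classical_set_scope.
Local Open Scope ring_scope.

(** * Signed powers and a mean value inequality *)

(** The kernel K may change sign between m and v, so |K|^p needs a primitive valid across zero. At 0
    the difference quotient is |h|^p, which tends to 0. *)
Lemma is_derive_mulr_norm_powR {R : realType} (p s : R) : 0 < p ->
  is_derive s 1 (fun x => x * `|x| `^ p) ((p + 1) * `|s| `^ p).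
Proof.
move=> p0; have [s0|s0|->] := ltgtP s 0.
- have -> : (p + 1) * `|s| `^ p = - ((p + 1) * (- s) `^ (p + 1 - 1) * -1).
    by rewrite ltr0_norm// addrK; ring.
  apply: (@near_eq_is_derive _ _ _ (fun x => - (- x) `^ (p + 1))).
    near=> x; have x0 : x < 0 by near: x; exact: lt_nbhsl.
    rewrite ltr0_norm// powRD ?powRr1; first by ring.
    - by rewrite oppr_ge0 ltW.
    - by rewrite oppr_eq0 (lt_eqF x0) implybT.
  apply: (@is_deriveN _ _ _ (fun x => (- x) `^ (p + 1))).
  apply: (@is_derive1_comp _ (@powR R ^~ (p + 1)) -%R).
  by apply: is_derive1_powR; rewrite oppr_gt0.
- have -> : (p + 1) * `|s| `^ p = (p + 1) * s `^ (p + 1 - 1).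
    by rewrite gtr0_norm// addrK.
  apply: (@near_eq_is_derive _ _ _ (@powR R ^~ (p + 1))); last first.
    exact: is_derive1_powR.
  near=> x; have x0 : 0 < x by near: x; exact: lt_nbhsr.
  rewrite /= gtr0_norm// powRD ?powRr1 1?mulrC ?(ltW x0)//.
  by rewrite (gt_eqF x0) implybT.
- rewrite normr0 powR0 ?gt_eqF// mulr0.
  suff H : h^-1 *: ((h *: (1:R) + 0) * `|h *: (1:R) + 0| `^ p - 0 * `|0:R| `^ p)
      @[h --> (0:R)^'] --> (0:R).
    by apply: DeriveDef; [apply/cvg_ex; exists 0 | apply/cvg_lim].
  have : `|h| `^ p @[h --> (0:R)^'] --> (0:R).
    apply/cvgrPdist_lt => e e0; near=> h.
    rewrite sub0r normrN ger0_norm ?powR_ge0//.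
    have -> : e = (e `^ p^-1) `^ p.
      by rewrite -powRrM mulVf ?gt_eqF// powRr1 ?ltW.
    rewrite gt0_ltr_powR ?nnegrE ?powR_ge0//.
    near: h; apply: dnbhs0_lt; exact: powR_gt0.
  apply: cvg_trans; apply: near_eq_cvg; near=> h.
  have h0 : h != 0 by near: h; exact: nbhs_dnbhs_neq.
  by rewrite /GRing.scale/= mulr1 addr0 mul0r subr0 mulrA mulVf// mul1r.
Unshelve. all: by end_near. Qed.

(** Both [w + g] and [w - g] have nonnegative derivative, hence are nondecreasing. The sign factor
    admits either order of [x] and [y], so that both choices of (u, v) are covered. *)
Lemma le_norm_sub_of_derive {R : realType} (a b : R) (g dg w dw : R -> R) :
  {within `[a, b], continuous g} -> {within `[a, b], continuous w} ->
  (forall x, x \in `]a, b[ -> is_derive x 1 g (dg x)) ->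
  (forall x, x \in `]a, b[ -> is_derive x 1 w (dw x)) ->
  (forall x, x \in `]a, b[ -> `|dg x| <= dw x) ->
  forall x y, x \in `[a, b] -> y \in `[a, b] ->
  `|g y - g x| <= Num.sg (y - x) * (w y - w x).
Proof.
move=> cg cw Dg Dw le_dgdw.
suff H x y : x \in `[a, b] -> y \in `[a, b] -> x < y ->
    `|g y - g x| <= w y - w x.
  move=> x y xab yab; have [xy|yx|->] := ltgtP x y.
  - by rewrite gtr0_sg ?subr_gt0// mul1r; exact: H.
  - by rewrite ltr0_sg ?subr_lt0// mulN1r opprB distrC; exact: H.
  - by rewrite !subrr normr0 mulr0.
move=> xab yab xy.
have xyab : `[x, y] `<=` `[a, b].
  by apply: subset_itv; rewrite bnd_simp ?(itvP xab) ?(itvP yab).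
have xyab' z : z \in `]x, y[ -> z \in `]a, b[.
  rewrite !in_itv/= => /andP[xz zy].
  by rewrite (le_lt_trans _ xz) ?(lt_le_trans zy) ?(itvP xab) ?(itvP yab).
have key (h dh : R -> R) : {within `[x, y], continuous h} ->
  (forall z, z \in `]x, y[ -> is_derive z 1 h (dh z)) ->
  (forall z, z \in `]x, y[ -> 0 <= dh z) -> 0 <= h y - h x.
  move=> ch Dh dh0; have [z zxy ->] := MVT xy Dh ch.
  by rewrite mulr_ge0 ?dh0// subr_ge0 ltW.
have cg' := continuous_subspaceW xyab cg.
have cw' := continuous_subspaceW xyab cw.
have H1 := key (fun z => g z + w z) (fun z => dg z + dw z).
have H2 := key (fun z => w z - g z) (fun z => dw z - dg z).
rewrite ler_norml; apply/andP; split; rewrite -subr_ge0.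
- have -> : g y - g x - - (w y - w x) = g y + w y - (g x + w x) by ring.
  apply: (H1 (within_continuousD cg' cw')
    (fun z zxy => is_deriveD (Dg z (xyab' z zxy)) (Dw z (xyab' z zxy)))).
  move=> z /xyab' /le_dgdw; rewrite ler_norml => /andP[+ _].
  by rewrite -subr_ge0 opprK.
- have -> : w y - w x - (g y - g x) = w y - g y - (w x - g x) by ring.
  apply: (H2 (within_continuousB cw' cg')
    (fun z zxy => is_deriveB (Dw z (xyab' z zxy)) (Dg z (xyab' z zxy)))).
  by move=> z /xyab' /le_dgdw; rewrite ler_norml subr_ge0 => /andP[].
Qed.

(** * Young's inequality and its optimisation *)

(** Young's inequality for d^(1/p) x and d^(-1/p) y; the exponent -q/p equals 1 - q. *)
Lemma young_scaled {R : realType} (p q d x y : R) :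
  0 < p -> 0 < q -> p^-1 + q^-1 = 1 -> 0 < d -> 0 <= x -> 0 <= y ->
  x * y <= d * x `^ p / p + d `^ (1 - q) * y `^ q / q.
Proof.
move=> p0 q0 pq d0 x0 y0.
have d1 : d `^ p^-1 * d `^ (- p^-1) = 1.
  by rewrite -powRD ?subrr ?powRr0// (gt_eqF d0) implybT.
have -> : x * y = (d `^ p^-1 * x) * (d `^ (- p^-1) * y).
  by rewrite mulrACA d1 mul1r.
apply: le_trans (conjugate_powR _ _ p0 q0 pq) _; rewrite ?mulr_ge0 ?powR_ge0//.
rewrite !powRM ?powR_ge0// -!powRrM mulVf ?gt_eqF// powRr1 ?(ltW d0)//.
suff -> : - p^-1 * q = 1 - q by [].
have -> : p^-1 = 1 - q^-1 by rewrite -pq addrK.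
by rewrite mulNr mulrBl mulVf ?gt_eqF// mul1r opprB.
Qed.

(* The optimal d is (Y / X)^(1/q); nonnegativity of Y is part of the
   conclusion because a negative Y would make some right-hand side negative. *)
Lemma holder_of_young {R : realType} (p q X Y Z : R) :
  0 < p -> 1 < q -> p^-1 + q^-1 = 1 -> 0 < X -> 0 <= Z ->
  (forall d, 0 < d -> Z <= d * X / p + d `^ (1 - q) * Y / q) ->
  0 <= Y /\ Z <= X `^ p^-1 * Y `^ q^-1.
Proof.
move=> p0 q1 pq X0 Z0 ZXY; have q0 : 0 < q by exact: lt_trans q1.
have dq d : 0 < d -> d `^ (1 - q) = d / d `^ q.
  move=> d0; rewrite powRD ?(gt_eqF d0) ?implybT// powRr1 ?(ltW d0)//.
  by rewrite powRN.
have [Y0|Y0|Y0] := ltgtP Y 0; last first.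
- rewrite {}Y0 in ZXY *; rewrite powR0 ?invr_eq0 ?gt_eqF// mulr0.
  split=> //; rewrite leNgt; apply/negP => {}Z0.
  (* This value of d turns the bound into Z <= Z/2, impossible for Z > 0. *)
  have := ZXY (Z * p / (2 * X)); rewrite mulr0 mul0r addr0.
  have -> : Z * p / (2 * X) * X / p = Z / 2 by field; rewrite !gt_eqF.
  have : 0 < Z * p / (2 * X) by rewrite divr_gt0 ?mulr_gt0.
  by move=> /[swap] /[apply]; lra.
- have r0 : 0 < Y / X by rewrite divr_gt0.
  pose d := (Y / X) `^ q^-1.
  have d0 : 0 < d by exact: powR_gt0.
  split=> //.
  apply: le_trans (ZXY d d0) _; rewrite dq//.
  have -> : d `^ q = Y / X by rewrite -powRrM mulVf ?gt_eqF// powRr1 ?ltW.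
  have -> : X `^ p^-1 * Y `^ q^-1 = d * X.
    rewrite /d powRM ?invr_ge0 ?ltW// -(powR_inv1 (ltW X0)) -powRrM.
    have -> : p^-1 = -1 * q^-1 + 1 by lra.
    by rewrite powRD ?powRr1 ?(ltW X0) ?(gt_eqF X0) ?implybT//; ring.
  have -> : d * X / p + d / (Y / X) * Y / q = d * X * (p^-1 + q^-1).
    by field; rewrite !gt_eqF.
  by rewrite pq mulr1.
- have r0 : 0 < - Y * p / (2 * q * X) by rewrite divr_gt0 ?mulr_gt0 ?oppr_gt0.
  (* With this d the second term is minus twice the first, so the bound is negative, against 0 <=
     Z. *)
  pose d := (- Y * p / (2 * q * X)) `^ q^-1.
  have d0 : 0 < d by exact: powR_gt0.
  have := le_trans Z0 (ZXY d d0); rewrite dq//.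
  have -> : d `^ q = - Y * p / (2 * q * X).
    by rewrite -powRrM mulVf ?gt_eqF// powRr1 ?ltW.
  have -> : d * X / p + d / (- Y * p / (2 * q * X)) * Y / q = - (d * X / p).
    by field; rewrite (lt_eqF Y0) !gt_eqF.
  by rewrite oppr_ge0 leNgt divr_gt0 ?mulr_gt0.
Qed.

(** * Continuity up to the endpoints and primitives *)

(** Write f y as the quotient times y - x, plus f x. The centre y = x, absent from the punctured
    filter, is treated separately. *)
Lemma derivable_within_cvg {R : realType} (J : set R) (f : R -> R) (x : R) :
  derivable_within J f x -> f y @[y --> within J (nbhs x)] --> f x.
Proof.
move=> /cvg_ex[l fl].
have FF : Filter (within J x^') by exact: within_filter.
have idx : (y - x) @[y --> within J x^'] --> (0 : R).
  rewrite -(subrr x); apply: cvgB; last exact: cvg_cst.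
  apply: cvg_trans; first exact: cvg_within.
  exact: cvg_within.
have := cvgD (cvgM fl idx) (cvg_cst (f x)); rewrite mulr0 add0r => H.
move=> A fxA; have {H} := H FF FF FF A fxA.
change (nbhs x (fun y => y != x -> J y ->
    A (diff_quotient f x y * (y - x) + f x)) ->
  nbhs x (fun y => J y -> A (f y))).
apply: filterS => y H Jy.
have [->|yx] := eqVneq y x; first exact: nbhs_singleton.
have := H yx Jy; rewrite /diff_quotient/=.
by rewrite mulfVK ?subr_eq0// subrK.
Qed.

(** The primitive is the integral from a. Continuity up to the endpoints matters because the
    increments from m to v reach a and b. *)
Lemma within_continuous_primitive {R : realType} (a b : R) (h : R -> R) :
  a < b -> {within `[a, b], continuous h} ->
  exists G : R -> R, [/\ {within `[a, b], continuous G},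
    (forall x, x \in `]a, b[ -> is_derive x 1 G (h x)) &
    G b - G a = \int[@lebesgue_measure R]_(x in `[a, b]) h x].
Proof.
move=> ab ch.
have ih : (@lebesgue_measure R).-integrable `[a, b] (EFin \o h).
  by apply: continuous_compact_integrable => //; exact: segment_compact.
exists (fun x => parameterized_integral (@lebesgue_measure R) a x h); split.
- exact: (parameterized_integral_continuous (ltW ab) ih).
- move=> x xab.
  have [ax xb] : a < x /\ x < b by rewrite !(itvP xab).
  have hx := within_continuous_continuous ab ch xab.
  have [dG GE] := continuous_FTC1_closed xb ih ax hx.
  by apply: DeriveDef => //; rewrite -derive1E.
- by rewrite /parameterized_integral set_itv1 Rintegral_set1 subr0.
Qed.

(** * The Young majorant in the variable A and its primitive *)

(** The case x = 0 arises when lambda is 0 or 1; there 1 + r = 0 must be excluded, since [powR]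
    gives 0 to the power 0 the value 1. *)
Lemma mulr_powR {R : realType} (x r : R) : 0 <= x -> 1 + r != 0 ->
  x * x `^ r = x `^ (1 + r).
Proof.
move=> x0 r0; have [->|x_neq0] := eqVneq x 0; first by rewrite mul0r powR0.
by rewrite powRD ?powRr1// x_neq0 implybT.
Qed.

(* K as a function of A = uv/x. *)
Definition young_kernel {R : realType} (lambda u v A : R) : R :=
  lambda - 2 * ((A - u) / (v - u)).

(* Primitive, with respect to A, of 1/(v - u) times the Young majorant of
   |K f'| / A^2. *)
Definition young_primitive {R : realType} (p q lambda u v gu gv d A : R) : R :=
  d `^ (1 - q) / (q * (v - u) ^+ 2) *
    ((gu - gv) / (2 - 2 * q) * A `^ (2 - 2 * q)
     + (v * gv - u * gu) / (1 - 2 * q) * A `^ (1 - 2 * q))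
  - d / (2 * p * (p + 1)) *
    (young_kernel lambda u v A * `|young_kernel lambda u v A| `^ p).

Lemma is_derive_young_kernel {R : realType} (lambda u v A : R) :
  is_derive A 1 (young_kernel lambda u v) (- (2 / (v - u))).
Proof.
rewrite /young_kernel.
apply: is_derive_eq (is_deriveB (is_derive_cst lambda A 1)
  (is_deriveZ 2 (is_deriveM (is_deriveB (is_derive_id A 1)
     (is_derive_cst u A 1)) (is_derive_cst (v - u)^-1 A 1)))) _.
by rewrite /GRing.scale/=; ring.
Qed.

(** With t = (A - u)/(v - u), t gu + (1 - t) gv = ((gu - gv) A + v gv - u gu)/(v - u), so
    multiplying by A^(-2q) leaves two plain powers of A. *)
Lemma is_derive_young_primitive {R : realType} (p q lambda u v gu gv d A : R) :
  0 < p -> 1 < q -> u != v -> 0 < A ->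
  is_derive A 1 (young_primitive p q lambda u v gu gv d)
    ((d * `|young_kernel lambda u v A| `^ p / p
      + d `^ (1 - q) * (((A - u) / (v - u) * gu + (1 - (A - u) / (v - u)) * gv)
          * A `^ (- (2 * q))) / q) / (v - u)).
Proof.
move=> p0 q1 uv A0; rewrite /young_primitive.
have vu0 : v - u != 0 by rewrite subr_eq0 eq_sym.
have DP := @is_derive1_comp _ (fun x => x * `|x| `^ p) _ _ _ _
  (is_derive_mulr_norm_powR p (young_kernel lambda u v A) p0)
  (is_derive_young_kernel lambda u v A).
have D := (is_deriveB
  (is_deriveZ (d `^ (1 - q) / (q * (v - u) ^+ 2))
    (is_deriveD
      (is_deriveZ ((gu - gv) / (2 - 2 * q)) (is_derive1_powR (2 - 2 * q) A0))
      (is_deriveZ ((v * gv - u * gu) / (1 - 2 * q))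
         (is_derive1_powR (1 - 2 * q) A0))))
  (is_deriveZ (d / (2 * p * (p + 1))) DP)).
refine (is_derive_eq D _).
have -> : 2 - 2 * q - 1 = 1 + - (2 * q) by ring.
have -> : 1 - 2 * q - 1 = - (2 * q) by ring.
(* Afterwards A^(-2q) is the only real power of A, an atom for [field]. *)
rewrite -(@mulr_powR _ A) ?(ltW A0)//; last by rewrite lt_eqF//; lra.
rewrite /GRing.scale/=.
field.
rewrite vu0/=; repeat (apply/andP; split);
  by [rewrite gt_eqF//; lra | rewrite lt_eqF//; lra].
Qed.

(** Source of the constants: A = u and A = (u + v)/2 correspond to x = v and x = m, where K is
    lambda and -(1 - lambda). The kernel part gives [C4], the powers of A give [C5] and [C6]. *)
Lemma young_primitive_sub {R : realType} (p q lambda u v gu gv d : R) :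
  0 < p -> 1 < q -> u != v -> 0 < u -> 0 < v -> 0 <= lambda <= 1 ->
  young_primitive p q lambda u v gu gv d ((u + v) / 2)
    - young_primitive p q lambda u v gu gv d u
  = d * (C4 lambda p / 2) / p
    + d `^ (1 - q) * ((C5 q u v * gu + C6 q u v * gv)
        / (2 * (1 - q) * (1 - 2 * q) * (v - u) ^+ 2)) / q.
Proof.
move=> p0 q1 uv u0 v0 /andP[l0 l1].
have vu0 : v - u != 0 by rewrite subr_eq0 eq_sym.
have Km : young_kernel lambda u v ((u + v) / 2) = - (1 - lambda).
  by rewrite /young_kernel; field.
have Ku : young_kernel lambda u v u = lambda.
  by rewrite /young_kernel subrr mul0r mulr0 subr0.
have p10 : 1 + p != 0 by rewrite gt_eqF// addr_gt0.
rewrite /young_primitive Km Ku normrN !ger0_norm ?subr_ge0// mulNr.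
rewrite !mulr_powR ?subr_ge0// /C4 /C5 /C6 [p + 1]addrC.
have E x : 0 < x -> x `^ (2 - 2 * q) = x * x `^ (1 - 2 * q).
  move=> x0; rewrite mulr_powR ?(ltW x0)//; first by congr (_ `^ _); ring.
  by rewrite lt_eqF//; lra.
rewrite !E ?divr_gt0 ?addr_gt0//.
field.
rewrite vu0 p10/=; repeat (apply/andP; split);
  by [rewrite gt_eqF//; lra | rewrite lt_eqF//; lra].
Qed.

Lemma is_derive_div {R : realType} (c x : R) : x != 0 ->
  is_derive x 1 (fun y => c / y) (- (c / x ^+ 2)).
Proof.
move=> x0.
have D := is_deriveZ c (is_deriveV (f := id) x0 (is_derive_id x 1)).
refine (is_derive_eq D _).
by rewrite /GRing.scale/= mulr1 mulrN.
Qed.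

(** * The estimate between m and one endpoint *)

(** Young is applied to |k| and |z|/A^2, since A^2 is |dA/dx| up to a constant; this produces the
    weight A^(-2q). *)
Lemma young_integrand {R : realType} (p q d k z A B : R) :
  0 < p -> 0 < q -> p^-1 + q^-1 = 1 -> 0 < d -> 0 < A -> `|z| `^ q <= B ->
  `|k * z| <= A ^+ 2 *
    (d * `|k| `^ p / p + d `^ (1 - q) * (B * A `^ (- (2 * q))) / q).
Proof.
move=> p0 q0 pq d0 A0 zB; have A2 : 0 < A ^+ 2 by rewrite exprn_gt0.
rewrite normrM [leRHS]mulrC -ler_pdivrMr// -[leLHS]mulrA.
have zA0 : 0 <= `|z| / A ^+ 2 by rewrite divr_ge0 ?(ltW A2).
apply: le_trans (young_scaled _ _ _ _ _ p0 q0 pq d0 (normr_ge0 k) zA0) _.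
rewrite lerD2l ler_pM2r ?invr_gt0//.
rewrite ler_pM2l ?powR_gt0// powRM ?invr_ge0 ?(ltW A2)//.
have -> : (A ^+ 2)^-1 `^ q = A `^ (- (2 * q)).
  by rewrite -powR_invn ?(ltW A0)// -powRrM mulNr.
by rewrite ler_pM2r ?powR_gt0.
Qed.

(** The norm on the left is that of psi v - psi m; [gu] and [gv] will be |f'(u)|^q and |f'(v)|^q. No
    order is imposed on u and v, so both halves are instances. *)
Lemma half_increment_bound {R : realType} (a b u v p q lambda gu gv : R)
    (f df G : R -> R) :
  0 < a -> u \in `[a, b] -> v \in `[a, b] -> u != v ->
  0 < p -> 1 < q -> p^-1 + q^-1 = 1 -> 0 <= lambda <= 1 ->
  {within `[a, b], continuous f} -> {within `[a, b], continuous G} ->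
  (forall x, x \in `]a, b[ -> is_derive x 1 f (df x)) ->
  (forall x, x \in `]a, b[ -> is_derive x 1 G (f x / x ^+ 2)) ->
  (forall x, x \in `]a, b[ -> `|df x| `^ q <=
     (u * v / x - u) / (v - u) * gu + (1 - (u * v / x - u) / (v - u)) * gv) ->
  `|lambda * f v + (1 - lambda) * f (2 * u * v / (u + v))
    - 2 * u * v / (v - u) * (G v - G (2 * u * v / (u + v)))|
  <= u * v * `|v - u| / 2 *
     (C4 lambda p `^ p^-1 / ((1 - q) * (1 - 2 * q) * (v - u) ^+ 2) `^ q^-1) *
     (C5 q u v * gu + C6 q u v * gv) `^ q^-1.
Proof.
move=> a0 uab vab uv p0 q1 pq l01 cf cG Df DG dfq.
have q0 : 0 < q by exact: lt_trans q1.
have [au ub] : a <= u /\ u <= b by rewrite !(itvP uab).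
have [av vb] : a <= v /\ v <= b by rewrite !(itvP vab).
have u0 : 0 < u by exact: lt_le_trans au.
have v0 : 0 < v by exact: lt_le_trans av.
have uv0 : 0 < u + v by exact: addr_gt0.
have vu0 : v - u != 0 by rewrite subr_eq0 eq_sym.
set m := 2 * u * v / (u + v).
have mab : m \in `[a, b].
  by rewrite in_itv/= ler_pdivlMr// ler_pdivrMr//; nra.
have pos x : x \in `[a, b] -> 0 < x.
  by rewrite in_itv/= => /andP[ax _]; exact: lt_le_trans ax.
pose K x := young_kernel lambda u v (u * v / x).
have DA (x : R) : 0 < x ->
    is_derive x 1 (fun y => u * v / y) (- (u * v / x ^+ 2)).
  by move=> x0; apply: is_derive_div; rewrite gt_eqF.
have DK (x : R) : 0 < x -> is_derive x 1 K (2 * u * v / (v - u) / x ^+ 2).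
  move=> x0.
  have D := is_derive1_comp (g := fun y => u * v / y)
    (is_derive_young_kernel lambda u v (u * v / x)) (DA x x0).
  by refine (is_derive_eq D _); ring.
have within_of_derive (h dh : R -> R) :
    (forall x : R, 0 < x -> is_derive x 1 h (dh x)) ->
    {within `[a, b], continuous h}.
  by move=> Dh; apply: derivable_within_continuous => x /pos /Dh [].
pose psi (x : R) : R := K x * f x - 2 * u * v / (v - u) * G x.
have cpsi : {within `[a, b], continuous psi}.
  move=> x; apply: cvgB; apply: cvgM.
  - exact: (within_of_derive _ _ DK x).
  - exact: cf.
  - exact: cvg_cst.
  - exact: cG.
have Dpsi x : x \in `]a, b[ -> is_derive x 1 psi (K x * df x).
  move=> xab; have x0 : 0 < x by apply: pos; exact: subset_itv_oo_cc.
  have D := is_deriveB (is_deriveM (DK x x0) (Df x xab))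
    (is_deriveZ (2 * u * v / (v - u)) (DG x xab)).
  by refine (is_derive_eq D _); rewrite /GRing.scale/=; ring.
have C4_gt0 : 0 < C4 lambda p.
  move: l01 => /andP[l0 l1].
  rewrite divr_gt0 ?(addr_gt0 p0)//; have [->|l_neq0] := eqVneq lambda 0.
    by rewrite subr0 powR1 ltr_wpDl// powR_ge0.
  by rewrite ltr_pwDl ?powR_ge0// powR_gt0// lt_def l_neq0.
have uvvu : 0 < u * v * `|v - u| by rewrite !mulr_gt0 ?normr_gt0.
set D := (1 - q) * (1 - 2 * q) * (v - u) ^+ 2.
have D0 : 0 < D by rewrite /D mulr_gt0 ?exprn_even_gt0//; nra.
set Y := C5 q u v * gu + _; set Z := (leLHS).
(* Shape of [holder_of_young] with X = C4/2. The factors 1/2 recombine to a single 1/2 because 1/p +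
   1/q = 1, and Y >= 0 allows the power of the product to be split. *)
suff [Y0 ZXY] : 0 <= Y / (2 * D) /\
    Z / (u * v * `|v - u|) <= (C4 lambda p / 2) `^ p^-1 * (Y / (2 * D)) `^ q^-1.
  have {}Y0 : 0 <= Y by move: Y0; rewrite pmulr_lge0// invr_gt0 mulr_gt0.
  move: ZXY; rewrite ler_pdivrMr// => /le_trans; apply.
  rewrite le_eqVlt; apply/orP; left; apply/eqP.
  have h2 : (2^-1 : R) `^ p^-1 * 2^-1 `^ q^-1 = 2^-1.
    by rewrite -powRD ?pq ?powRr1// ?invr_ge0// oner_eq0.
  have h0 : 0 <= (2^-1 : R) by rewrite invr_ge0.
  have Di0 : 0 <= D^-1 by rewrite invr_ge0 ltW.
  have D1 : D^-1 `^ q^-1 = (D `^ q^-1)^-1.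
    by rewrite -powR_inv1 ?(ltW D0)// -powRrM mulN1r powRN.
  rewrite invfM (powRM _ (ltW C4_gt0) h0) (powRM _ Y0 (mulr_ge0 h0 Di0)).
  rewrite (powRM _ h0 Di0) D1.
  transitivity (u * v * `|v - u| * (2^-1 `^ p^-1 * 2^-1 `^ q^-1)
    * (C4 lambda p `^ p^-1 / D `^ q^-1) * Y `^ q^-1); first by ring.
  by rewrite h2.
apply: holder_of_young => //; first exact: divr_gt0.
  by apply: divr_ge0; [exact: normr_ge0 | exact: ltW].
move=> d d0.
have -> : 2 * D = 2 * (1 - q) * (1 - 2 * q) * (v - u) ^+ 2 by rewrite /D; ring.
rewrite -(young_primitive_sub p q lambda u v gu gv d)//.
pose S := young_primitive p q lambda u v gu gv d.
(* As dA/dx = -A^2/(uv) and S' carries a factor 1/(v - u), this constant makes W' equal to A^2 times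
   the majorant. *)
pose W x := u * v * (u - v) * S (u * v / x).
have A0 (x : R) : 0 < x -> 0 < u * v / x.
  by move=> x0; rewrite divr_gt0 ?mulr_gt0.
pose dW x := (u * v / x) ^+ 2 * (d * `|K x| `^ p / p + d `^ (1 - q) *
  (((u * v / x - u) / (v - u) * gu + (1 - (u * v / x - u) / (v - u)) * gv)
    * (u * v / x) `^ (- (2 * q))) / q).
have DW (x : R) : 0 < x -> is_derive x 1 W (dW x).
  move=> x0.
  have dWx := is_deriveZ (u * v * (u - v)) (is_derive1_comp
    (g := fun y => u * v / y)
    (is_derive_young_primitive p q lambda u v gu gv d _ p0 q1 uv (A0 x x0))
    (DA x x0)).
  refine (is_derive_eq dWx _); rewrite /GRing.scale/= /dW /K.
  by field; rewrite vu0 !gt_eqF.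
have := le_norm_sub_of_derive a b psi (fun x => K x * df x) W dW cpsi
  (within_of_derive _ _ DW) Dpsi.
move=> /(_ (fun x xab => DW x (pos x (subset_itv_oo_cc xab)))).
have dpsiW x : x \in `]a, b[ -> `|K x * df x| <= dW x.
  move=> xab; apply: young_integrand => //; last exact: dfq.
  by apply: A0; apply: pos; exact: subset_itv_oo_cc.
move=> /(_ dpsiW m v mab vab).
have Av : u * v / v = u by rewrite mulfK ?gt_eqF.
have Am : u * v / m = (u + v) / 2 by rewrite /m; field; rewrite !gt_eqF.
(* v - m has the sign of v - u, so the sign factor turns v - u into its absolute value. *)
have -> : v - m = v / (u + v) * (v - u) by rewrite /m; field; rewrite gt_eqF.
rewrite sgrM gtr0_sg ?divr_gt0// mul1r.
have -> : Num.sg (v - u) * (W v - W m) =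
    u * v * `|v - u| * (S ((u + v) / 2) - S u).
  by rewrite /W Av Am normrEsg; ring.
rewrite ler_pdivrMr// [_ * (S _ - S u)]mulrC /Z; congr (`|_| <= _).
rewrite /psi /K Av Am /young_kernel subrr mul0r mulr0 subr0.
by field; rewrite vu0.
Qed.

(** * Combining the two halves *)

Theorem theorem7 (R : realType) (I : set R) (f : R -> R) (a b p q : R)
  (hI : is_interval I) (hIpos : I `<=` [set x | 0 < x])
  (hfI : forall x, I° x -> derivable f x 1)
  (ha : I a) (hb : I b) (hab : a < b)
  (hfab : forall x, a <= x <= b -> derivable_within I f x)
  (hf'int : (@lebesgue_measure R).-integrable `[a, b]
              (EFin \o derive_within I f))
  (hq : 1 < q) (hpq : 1 / p + 1 / q = 1)
  (hconv : harmonically_convex `[a, b]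
             (fun x => `|derive_within I f x| `^ q)) :
  forall lambda : R, 0 <= lambda <= 1 ->
  `| (1 - lambda) * f (2 * a * b / (a + b)) + lambda * ((f a + f b) / 2)
     - a * b / (b - a) *
         \int[@lebesgue_measure R]_(x in `[a, b]) (f x / x ^+ 2) |
  <= a * b * (b - a) / 4
     * (C4 lambda p `^ (1 / p)
        / ((1 - q) * (1 - 2 * q) * (b - a) ^+ 2) `^ (1 / q))
     * ((C5 q a b * `|derive_within I f a| `^ q
         + C6 q a b * `|derive_within I f b| `^ q) `^ (1 / q)
        + (C6 q b a * `|derive_within I f a| `^ q
           + C5 q b a * `|derive_within I f b| `^ q) `^ (1 / q)).
Proof.
move=> lambda l01.
have q0 : 0 < q by exact: lt_trans hq.
have pq : p^-1 + q^-1 = 1 by rewrite !div1r in hpq.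
have p0 : 0 < p.
  have : q^-1 < 1 by rewrite invf_lt1.
  by rewrite -invr_gt0; lra.
have a0 : 0 < a by exact: hIpos.
have b0 : 0 < b by exact: lt_trans hab.
have abI x : x \in `[a, b] -> I x.
  by rewrite in_itv/= => /(hI a b ha hb x).
have cf : {within `[a, b], continuous f}.
  apply/subspace_continuousP => x xab A fxA.
  have := derivable_within_cvg I f x (hfab x xab) A fxA.
  change (nbhs x (fun y => I y -> A (f y)) ->
    nbhs x (fun y => y \in `[a, b] -> A (f y))).
  by apply: filterS => y IA /abI.
have ch : {within `[a, b], continuous (fun x => f x / x ^+ 2)}.
  have cV : {within `[a, b], continuous (fun x : R => (x ^+ 2)^-1)}.
    apply: derivable_within_continuous => x; rewrite in_itv/= => /andP[ax _].
    by apply: derivableV => //; rewrite expf_neq0// gt_eqF// (lt_le_trans a0).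
  by move=> x; apply: cvgM; [exact: cf|exact: cV].
have [G [cG DG <-]] := within_continuous_primitive a b _ hab ch.
have Df x : x \in `]a, b[ -> is_derive x 1 f (derive_within I f x).
  move=> xab; have Ix : I° x.
    apply: filterS (near_in_itvoo xab) => y yab.
    by apply: abI; exact: subset_itv_oo_cc.
  by apply: DeriveDef; [exact: hfI | rewrite derive_withinE// derive1E].
pose g x := `|derive_within I f x| `^ q.
have dfq u v x : 0 < u -> 0 < v -> u \in `[a, b] -> v \in `[a, b] -> u != v ->
    u * v = a * b -> u + v = a + b -> x \in `]a, b[ -> g x <=
    (u * v / x - u) / (v - u) * g u + (1 - (u * v / x - u) / (v - u)) * g v.
  move=> u0 v0 uab vab uv uvE uvD xab.
  have [ax xb] : a < x /\ x < b by rewrite !(itvP xab).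
  have x0 : 0 < x by exact: lt_trans ax.
  set t := (_ / _ - _) / _.
  have vu0 : v - u != 0 by rewrite subr_eq0 eq_sym.
  have tE : t * v + (1 - t) * u = u * v / x.
    by rewrite /t; field; rewrite vu0 gt_eqF.
  have t01 : 0 <= t <= 1.
    (* The right side is symmetric in u and v, so t (1 - t) >= 0, and hence 0 <= t <= 1, whichever
       endpoint u is. *)
    have tt : t * (1 - t) = u * v * ((x - a) * (b - x)) / (x * (v - u)) ^+ 2.
      have -> : (x - a) * (b - x) = (u + v) * x - u * v - x ^+ 2.
        by rewrite uvE uvD; ring.
      by rewrite /t; field; rewrite vu0 gt_eqF.
    have : 0 <= t * (1 - t).
      by rewrite tt divr_ge0 ?sqr_ge0// !mulr_ge0 ?subr_ge0 ?ltW.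
    by clear; nra.
  have xE : v * u / (u * v / x) = x by field; rewrite !gt_eqF.
  (* The points are taken in the order v, u because t weights the first point in the mean but the
     value at the second one in the bound. *)
  by have := hconv v u t vab uab t01; rewrite tE xE.
have aab : a \in `[a, b] by rewrite in_itv/= lexx ltW.
have bab : b \in `[a, b] by rewrite in_itv/= lexx ltW.
have ab : a != b by rewrite lt_eqF.
have ba : b != a by rewrite gt_eqF.
have Hab := half_increment_bound a b a b p q lambda (g a) (g b) f _ G
  a0 aab bab ab p0 hq pq l01 cf cG Df DG
  (fun x => dfq a b x a0 b0 aab bab ab erefl erefl).
have Hba := half_increment_bound a b b a p q lambda (g b) (g a) f _ G
  a0 bab aab ba p0 hq pq l01 cf cG Df DG
  (fun x => dfq b a x b0 a0 bab aab ba (mulrC b a) (addrC b a)).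
rewrite !div1r; set C := _ / _ `^ q^-1 in Hab *.
set m := 2 * a * b / (a + b) in Hab *.
have mE : 2 * b * a / (b + a) = m by rewrite /m; congr (_ / _); ring.
have bE : (a - b) ^+ 2 = (b - a) ^+ 2 by ring.
rewrite mE bE [C5 q b a * _ + _]addrC [`|a - b|]distrC in Hba.
have ba_gt0 : 0 < b - a by rewrite subr_gt0.
rewrite -/C in Hba; rewrite (gtr0_norm ba_gt0) in Hab Hba.
rewrite -/(g a) -/(g b).
have ba0 : b - a != 0 by rewrite gt_eqF.
have ab0 : a - b != 0 by rewrite subr_eq0.
(* In the sum of the two increments the values of G at m cancel, leaving G b - G a; half of that sum
   is the left side. *)
apply: (le_trans (y := (_ + _) / 2)); last first.
  apply: le_trans (ler_wpM2r _ (lerD Hab Hba)) _; first by rewrite invr_ge0.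
  by rewrite le_eqVlt; apply/orP; left; apply/eqP; field.
rewrite ler_pdivlMr// -[X in _ * X]ger0_norm// -normrM.
apply: le_trans (ler_normD _ _); rewrite le_eqVlt; apply/orP; left; apply/eqP.
by congr `|_|; field; rewrite ba0 ab0.
Qed.
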